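(* Let $\Omega$ be a closed subset of $\mathbb{R}^n$ with $\bar x\in\Omega$, and let $\bar v\in N^p_\Omega(\bar x)$ be a proximal normal. Assume that $\Omega$ is parabolically derivable at $\bar x$ for every vector $w\in K_\Omega(\bar x,\bar v)$. If $\Omega$ is parabolically regular at $\bar x$ for $\bar v$, then the indicator function $\delta_\Omega$ is properly twice epi-differentiable at $\bar x$ for $\bar v$, and its second subderivative is given by $$\mathrm{d}^2\delta_\Omega(\bar x,\bar v)(w)=\begin{cases}-\sigma_{T^2_\Omega(\bar x,w)}(\bar v)&\text{if } w\in K_\Omega(\bar x,\bar v),\\ \infty&\text{otherwise.}\end{cases}$$
   Context: $\delta_\Omega$ is the indicator function of $\Omega$ ($0$ on $\Omega$, $+\infty$ off $\Omega$); $\sigma_A(v)=\sup_{u\in A}\langle v,u\rangle$ is the support function of $A$. Tangent cone: $T_\Omega(\bar x)=\{w:\exists t_k\downarrow0,\ w_k\to w,\ \bar x+t_kw_k\in\Omega\}$. Proximal normals: $N^p_\Omega(\bar x)$ is the set of $v$ for which there is $r\ge0$ with $\langle v,x-\bar x\rangle\le r\|x-\bar x\|^2$ for all $x\in\Omega$. Critical cone: $K_\Omega(\bar x,\bar v)=T_\Omega(\bar x)\cap\{\bar v\}^\perp$. Second-order tangent set: $T^2_\Omega(\bar x,w)=\{u:\exists t_k\downarrow0,\ u_k\to u,\ \bar x+t_kw+\tfrac12t_k^2u_k\in\Omega\}$. $\Omega$ is parabolically derivable at $\bar x$ for $w$ if $T^2_\Omega(\bar x,w)\ne\emptyset$ and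 for each $u\in T^2_\Omega(\bar x,w)$ there are $\varepsilon>0$ and an arc $\xi:[0,\varepsilon]\to\Omega$ with $\xi(0)=\bar x$, $\xi'_+(0)=w$ and $\xi''_+(0):=\lim_{t\downarrow0}\frac{\xi(t)-\xi(0)-t\xi'_+(0)}{\frac12t^2}=u$, where $\xi'_+(0)$ is the right derivative at $0$. Second-order difference quotients: $\Delta_t^2\varphi(\bar x,\bar v)(u)=\frac{\varphi(\bar x+tu)-\varphi(\bar x)-t\langle\bar v,u\rangle}{\frac12t^2}$, $t>0$. Second subderivative: $\mathrm{d}^2\varphi(\bar x,\bar v)(w)=\liminf_{t\downarrow0,\,u\to w}\Delta_t^2\varphi(\bar x,\bar v)(u)$. A function $\varphi$ is twice epi-differentiable at $\bar x$ for $\bar v$ if the sets $\operatorname{epi}\Delta_t^2\varphi(\bar x,\bar v)$ converge (Painlevé–Kuratowski) to $\operatorname{epi}\mathrm{d}^2\varphi(\bar x,\bar v)$ as $t\downarrow0$; equivalently, for every $w$ and every $t_k\downarrow0$ there is $w_k\to w$ with $\Delta_{t_k}^2\varphi(\bar x,\bar v)(w_k)\to\mathrm{d}^2\varphi(\bar x,\bar v)(w)$. It is properly twice epi-differentiable if in addition $\mathrm{d}^2\varphi(\bar x,\bar v)$ is proper (never $-\infty$, not identically $\infty$). $\Omega$ is parabolically regular at $\bar x\in\Omega$ for $\bar v$ if for every $w$ with $\mathrm{d}^2\delta_\Omega(\bar x,\bar v)(w)<\infty$ there exist sequences $t_k\downarrow0$, $w_k\to w$ with $\Delta^2_{t_k}\delta_\Omega(\bar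 x,\bar v)(w_k)\to\mathrm{d}^2\delta_\Omega(\bar x,\bar v)(w)$ and $\limsup_{k\to\infty}\|w_k-w\|/t_k<\infty$. *)

(* Defs.v *)
From HB Require Import structures.
From mathcomp Require Import all_boot all_order all_algebra.
From mathcomp Require Import all_classical all_reals all_analysis.
Set Implicit Arguments.
Unset Strict Implicit.
Unset Printing Implicit Defensive.
Import Order.TTheory GRing.Theory Num.Theory.
Import numFieldNormedType.Exports.
Local Open Scope classical_set_scope.
Local Open Scope ring_scope.

(* Vectors of R^n are row vectors 'rV[R]_n.  Their library topology is the
   usual (entrywise) one, but the library norm `|u| is the max norm, hence the
   separate Euclidean norm below. *)

Definition dotp (R : realType) (n : nat) (u v : 'rV[R]_n) : R :=
  \sum_(i < n) u ord0 i * v ord0 i.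

Definition enorm (R : realType) (n : nat) (u : 'rV[R]_n) : R :=
  Num.sqrt (dotp u u).

(* The variational-analysis convention: t_k -> 0 with every t_k > 0; the
   sequence need not be monotone. *)
Definition decr0 (R : realType) (t : R^nat) : Prop :=
  (forall k, 0 < t k) /\ t @ \oo --> (0 : R).

Definition indicator (R : realType) (n : nat) (Omega : set 'rV[R]_n)
  (x : 'rV[R]_n) : \bar R := if x \in Omega then 0%E else +oo%E.

Definition support_fun (R : realType) (n : nat) (A : set 'rV[R]_n)
  (v : 'rV[R]_n) : \bar R := ereal_sup [set (dotp v u)%:E | u in A].

Definition tangent_cone (R : realType) (n : nat) (Omega : set 'rV[R]_n)
    (x : 'rV[R]_n) : set 'rV[R]_n :=
  [set w | exists (t : R^nat) (w_ : nat -> 'rV[R]_n),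
    [/\ decr0 t, w_ @ \oo --> w & forall k, Omega (x + t k *: w_ k)]].

Definition proximal_normal (R : realType) (n : nat) (Omega : set 'rV[R]_n)
    (x : 'rV[R]_n) : set 'rV[R]_n :=
  [set v | exists2 r : R, 0 <= r &
    forall y, Omega y -> dotp v (y - x) <= r * enorm (y - x) ^+ 2].

Definition critical_cone (R : realType) (n : nat) (Omega : set 'rV[R]_n)
    (x v : 'rV[R]_n) : set 'rV[R]_n :=
  tangent_cone Omega x `&` [set w | dotp v w = 0].

Definition tangent_set2 (R : realType) (n : nat) (Omega : set 'rV[R]_n)
    (x w : 'rV[R]_n) : set 'rV[R]_n :=
  [set u | exists (t : R^nat) (u_ : nat -> 'rV[R]_n),
    [/\ decr0 t, u_ @ \oo --> u &
      forall k, Omega (x + t k *: w + (2^-1 * t k ^+ 2) *: u_ k)]].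

(* An arc [0, eps] -> Omega is a function on R, of which only the values on
   [0, eps] matter. *)
Definition parabolically_derivable (R : realType) (n : nat)
    (Omega : set 'rV[R]_n) (x w : 'rV[R]_n) : Prop :=
  tangent_set2 Omega x w !=set0 /\
  forall u, tangent_set2 Omega x w u ->
    exists (eps : R) (xi : R -> 'rV[R]_n),
      [/\ 0 < eps,
          forall t : R, 0 <= t <= eps -> Omega (xi t),
          xi 0 = x,
          t^-1 *: (xi t - xi 0) @[t --> 0^'+] --> w &
          (2^-1 * t ^+ 2)^-1 *: (xi t - xi 0 - t *: w) @[t --> 0^'+] --> u].

(* Meant for phi x finite and t > 0; when phi takes the value +oo at
   x + t *: u, so does the quotient at u. *)
Definition diff_quot2 (R : realType) (n : nat) (phi : 'rV[R]_n -> \bar R)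
    (x v : 'rV[R]_n) (t : R) (u : 'rV[R]_n) : \bar R :=
  ((phi (x + t *: u)%R - phi x - (t * dotp v u)%:E)
    * ((2^-1 * t ^+ 2)^-1)%:E)%E.

Definition subderivative2 (R : realType) (n : nat) (phi : 'rV[R]_n -> \bar R)
    (x v w : 'rV[R]_n) : \bar R :=
  limf_einf (fun z : R * 'rV[R]_n => diff_quot2 phi x v z.1 z.2)
    (filter_prod 0^'+ (nbhs w)).

Definition epigraph (R : realType) (T : Type) (f : T -> \bar R) :
    set (T * R) :=
  [set z | (f z.1 <= z.2%:E)%E].

(* Painleve-Kuratowski inner and outer limits of E t as t decreases to 0. *)
Definition inner_limit0 (R : realType) (T : topologicalType)
    (E : R -> set T) : set T :=
  [set z | forall t : R^nat, decr0 t ->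
    exists2 z_ : nat -> T, z_ @ \oo --> z &
      \forall k \near \oo, E (t k) (z_ k)].

Definition outer_limit0 (R : realType) (T : topologicalType)
    (E : R -> set T) : set T :=
  [set z | exists (t : R^nat) (z_ : nat -> T),
    [/\ decr0 t, z_ @ \oo --> z & forall k, E (t k) (z_ k)]].

Definition PK_converges0 (R : realType) (T : topologicalType)
    (E : R -> set T) (L : set T) : Prop :=
  inner_limit0 E = L /\ outer_limit0 E = L.

Definition proper_fun (R : realType) (T : Type) (f : T -> \bar R) : Prop :=
  (forall w, f w != -oo%E) /\ exists w, f w != +oo%E.

Definition twice_epi_differentiable (R : realType) (n : nat)
    (phi : 'rV[R]_n -> \bar R) (x v : 'rV[R]_n) : Prop :=
  PK_converges0 (fun t => epigraph (diff_quot2 phi x v t))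
    (epigraph (subderivative2 phi x v)).

Definition properly_twice_epi_differentiable (R : realType) (n : nat)
    (phi : 'rV[R]_n -> \bar R) (x v : 'rV[R]_n) : Prop :=
  twice_epi_differentiable phi x v /\ proper_fun (subderivative2 phi x v).

Definition parabolically_regular (R : realType) (n : nat)
    (Omega : set 'rV[R]_n) (x v : 'rV[R]_n) : Prop :=
  forall w, (subderivative2 (indicator Omega) x v w < +oo)%E ->
    exists (t : R^nat) (w_ : nat -> 'rV[R]_n),
      [/\ decr0 t, w_ @ \oo --> w,
          diff_quot2 (indicator Omega) x v (t k) (w_ k) @[k --> \oo]
            --> subderivative2 (indicator Omega) x v w &
          (limn_esup (fun k => (enorm (w_ k - w) / t k)%:E) < +oo)%E].

(* Main.v *)
Require Import Defs.
From mathcomp Require Import all_boot all_order all_algebra.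
From mathcomp Require Import all_classical all_reals all_analysis.
From mathcomp Require Import ring lra.
Import Order.TTheory GRing.Theory Num.Theory.
Import numFieldNormedType.Exports.
Local Open Scope classical_set_scope.
Local Open Scope ring_scope.

(** Writing [w_k = w + (t_k / 2) u_k], the point [x + t_k w_k] is
    [x + t_k w + t_k^2 / 2 u_k], and for [w] orthogonal to [v] the difference
    quotient of the indicator at [w_k] is [- <v, u_k>] when this point lies in
    [Omega]. Hence second-order tangents bound the second subderivative from
    above. Parabolic regularity provides an optimal sequence with [u_k] bounded,
    and a limit point of [u_k] is a second-order tangent at which the bound is
    attained. The arc given by parabolic derivability for this tangent yields
    recovery sequences along every [t_k], i.e. epi-convergence. The proximal
    inequality excludes the value -oo and forces directions with finite second
    subderivative to be critical. *)

(** * Euclidean inner product and its continuity *)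

Section dotp.
Context {R : realType} {n : nat}.
Implicit Types (u v w : 'rV[R]_n) (a : R).

Lemma dotpDr v u w : dotp v (u + w) = dotp v u + dotp v w.
Proof. by rewrite /dotp -big_split; apply: eq_bigr => i _; rewrite mxE mulrDr.
Qed.

Lemma dotpZr v a u : dotp v (a *: u) = a * dotp v u.
Proof.
by rewrite /dotp big_distrr; apply: eq_bigr => i _; rewrite mxE mulrCA.
Qed.

Lemma dotpZl v a u : dotp (a *: v) u = a * dotp v u.
Proof.
by rewrite /dotp big_distrr; apply: eq_bigr => i _; rewrite mxE -mulrA.
Qed.

Lemma dotpBr v u w : dotp v (u - w) = dotp v u - dotp v w.
Proof. by rewrite -scaleN1r dotpDr dotpZr mulN1r. Qed.

Lemma dotp_ge0 u : 0 <= dotp u u.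
Proof. by apply: sumr_ge0 => i _; rewrite -expr2 sqr_ge0. Qed.

Lemma coord_le_enorm u i : `|u ord0 i| <= enorm u.
Proof.
rewrite -sqrtr_sqr ler_sqrt ?dotp_ge0// /dotp (bigD1 i)//= -expr2 lerDl.
by apply: sumr_ge0 => j _; rewrite -expr2 sqr_ge0.
Qed.

Lemma cvg_dotp (T : Type) (F : set_system T) (FF : Filter F)
    (f g : T -> 'rV[R]_n) u v :
  f @ F --> u -> g @ F --> v -> dotp (f x) (g x) @[x --> F] --> dotp u v.
Proof.
move=> fu gv; rewrite /dotp.
apply: (@cvg_big _ _ +%R) => [|i _]; first exact: add_continuous.
have cc := @coord_continuous R 1 n ord0 i.
exact: cvgM (cvg_comp _ _ fu (cc u)) (cvg_comp _ _ gv (cc v)).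
Qed.

End dotp.

(** * Step-size sequences, subsequences and bounds from a finite limsup *)

Section sequences.
Context {R : realType}.

Lemma decr0_harmonic : decr0 (@harmonic R).
Proof. by split=> [k|]; [exact: harmonic_gt0 | exact: cvg_harmonic]. Qed.

Lemma decr0_shift (t : R^nat) N : decr0 t -> decr0 (fun k => t (k + N)%N).
Proof. by move=> [t0 tcvg]; split=> //; rewrite (cvg_shiftn N t). Qed.

Lemma decr0_at_right (t : R^nat) : decr0 t -> t @ \oo --> 0^'+.
Proof.
move=> [t0 tcvg] A [e /= e0 eA].
have : \forall k \near \oo, ball 0 e (t k) by apply: tcvg; exact: nbhsx_ballx.
by apply: filterS => k ke; apply: eA.
Qed.

Lemma cvg_ball_harmonic {T : pseudoMetricType R} (x : T) (u : T^nat) :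
  (forall k, ball x (harmonic k) (u k)) -> u @ \oo --> x.
Proof.
move=> ux; apply/cvg_ballP => e e0.
near=> k; apply: (le_ball _ (ux k)); apply: ltW.
by near: k; exact: (near_infty_natSinv_lt (PosNum e0)).
Unshelve. all: by end_near. Qed.

(** A cluster point [x] has terms [u m] with [k <= m] within [harmonic k] of it. The chosen [f] need
    not be increasing; [f k >= k] is enough for [f] to tend to infinity. *)
Lemma compact_cvg_subsequence {T : pseudoMetricType R} (A : set T) (u : T^nat) :
  compact A -> (\forall k \near \oo, A (u k)) ->
  exists (x : T) (f : nat -> nat),
    f @ \oo --> \oo /\ (u \o f) @ \oo --> x.
Proof.
move=> cA Au; have [x [_ ux]] := cA (u @ \oo) _ Au.
have pick k : exists m, (k <= m)%N /\ ball x (harmonic k) (u m).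
  have kA : (u @ \oo) (u @` [set m | (k <= m)%N]).
    by exists k => // m /= km; exists m.
  have h0 : 0 < harmonic k :> R := harmonic_gt0 k.
  by have [_ [[m km <-] xm]] := ux _ _ kA (nbhsx_ballx x _ h0); exists m.
have [f fP] := choice pick; exists x, f; split.
- move=> B [N _ NB]; exists N => // k /= Nk; apply: NB => /=.
  by apply: leq_trans Nk _; have [] := fP k.
- by apply: cvg_ball_harmonic => k; have [] := fP k.
Qed.

Lemma limn_esup_lty (e : R^nat) :
  (limn_esup (fun k => (e k)%:E) < +oo)%E ->
  exists C, \forall k \near \oo, e k <= C.
Proof.
move=> /ereal_inf_lt[_ [V Voo <-]] supV.
have [C VC] : exists C, (ereal_sup [set (e k)%:E | k in V] <= C%:E)%E.
  case: (ereal_sup _) supV => [C|//|] _; first by exists C.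
  by exists 0; rewrite leNye.
exists C; apply: filterS Voo => k Vk; rewrite -lee_fin.
by apply: le_trans VC; apply: ereal_sup_ubound; exists k.
Qed.

End sequences.

(** * Second subderivative through sequences, and epi-convergence *)

Section subderivative.
Context {R : realType} {n : nat}.
Variables (phi : 'rV[R]_n -> \bar R) (x v : 'rV[R]_n).
Implicit Types (w : 'rV[R]_n).

Lemma subderivative2E w : subderivative2 phi x v w =
  ereal_sup [set ereal_inf [set diff_quot2 phi x v z.1 z.2 | z in V] |
    V in filter_prod 0^'+ (nbhs w)].
Proof.
rewrite /subderivative2 /limf_einf /limf_esup /= -ereal_supN image_comp.
congr ereal_sup; apply: eq_imagel => V _ /=.
rewrite -ereal_infN image_comp; congr ereal_inf.
by apply: eq_imagel => z _ /=; rewrite oppeK.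
Qed.

(** The pairs [(t k, w_ k)] eventually enter each [V] of the filter, so the infimum over [V] is
    eventually at most [q k], and hence at most the limit [a]. *)
Lemma subderivative2_le_cvg w (t : R^nat) (w_ : nat -> 'rV[R]_n) (q : R^nat) a :
  decr0 t -> w_ @ \oo --> w ->
  (\forall k \near \oo, (diff_quot2 phi x v (t k) (w_ k) <= (q k)%:E)%E) ->
  q @ \oo --> a -> (subderivative2 phi x v w <= a%:E)%E.
Proof.
move=> t0 ww dq qa; rewrite subderivative2E; apply/ereal_supP => _ [V FV <-].
have qaE : (q k)%:E @[k --> \oo] --> a%:E by apply: cvg_EFin => //; near=> k.
apply: (cvge_to_ge qaE).
have : \forall k \near \oo, V (t k, w_ k).
  exact: (cvg_pair (decr0_at_right _ t0) ww FV).
apply: filterS2 dq => k kq Vk; apply: le_trans kq.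
by apply: ereal_inf_lbound; exists (t k, w_ k).
Unshelve. all: by end_near. Qed.

(** Each infimum over a neighbourhood is below [a]; picking a point from each of a shrinking
    sequence of neighbourhoods gives the sequences. *)
Lemma subderivative2_lt_cvg w a :
  (subderivative2 phi x v w < a)%E ->
  exists (t : R^nat) (w_ : nat -> 'rV[R]_n),
    [/\ decr0 t, w_ @ \oo --> w &
      forall k, (diff_quot2 phi x v (t k) (w_ k) < a)%E].
Proof.
rewrite subderivative2E => lta.
have pick k : exists z : R * 'rV[R]_n,
    [/\ 0 < z.1, z.1 < harmonic k, ball w (harmonic k) z.2 &
      (diff_quot2 phi x v z.1 z.2 < a)%E].
  have h0 : 0 < harmonic k :> R := harmonic_gt0 k.
  pose V := [set z : R * 'rV[R]_n |
    [/\ 0 < z.1, z.1 < harmonic k & ball w (harmonic k) z.2]].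
  have FV : filter_prod 0^'+ (nbhs w) V.
    exists ([set s : R | 0 < s /\ s < harmonic k], ball w (harmonic k)) => /=.
      split; last exact: nbhsx_ballx.
      by near=> s; split; near: s; [exact: nbhs_right_gt | exact: nbhs_right_lt].
    by move=> [s u] /= [[? ?] ?].
  have : (ereal_inf [set diff_quot2 phi x v z.1 z.2 | z in V] < a)%E.
    by apply: le_lt_trans lta; apply: ereal_sup_ubound; exists V.
  by move=> /ereal_inf_lt[_ [z [? ? ?] <-] ?]; exists z.
have [z zP] := choice pick.
exists (fun k => (z k).1), (fun k => (z k).2); split.
- split; first by move=> k; have [] := zP k.
  apply: (@cvg_ball_harmonic R) => k; have [z0 zh _ _] := zP k.
  by rewrite /ball/= sub0r normrN gtr0_norm.
- by apply: cvg_ball_harmonic => k; have [] := zP k.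
- by move=> k; have [] := zP k.
Unshelve. all: by end_near. Qed.

(** Recovery sequences place the epigraph inside the inner limit. The inner limit lies in the outer
    limit, and the outer limit in the epigraph by definition of the liminf, so all three
    coincide. *)
Lemma twice_epi_differentiable_of_recovery :
  (forall w a, (subderivative2 phi x v w <= a%:E)%E ->
    forall t : R^nat, decr0 t -> exists (w_ : nat -> 'rV[R]_n) (q : R^nat),
      [/\ w_ @ \oo --> w, q @ \oo --> a &
        \forall k \near \oo, (diff_quot2 phi x v (t k) (w_ k) <= (q k)%:E)%E]) ->
  twice_epi_differentiable phi x v.
Proof.
move=> recov.
set E := fun t => epigraph (diff_quot2 phi x v t).
have epi_inner : epigraph (subderivative2 phi x v) `<=` inner_limit0 E.
  move=> [w a] /= wa t t0; have [w_ [q [ww qa dq]]] := recov w a wa t t0.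
  by exists (fun k => (w_ k, q k)) => //; exact: (cvg_pair ww qa).
have inner_outer : inner_limit0 E `<=` outer_limit0 E.
  move=> z /(_ _ decr0_harmonic)[z_ zz [N _ zE]].
  (* The inner limit gives membership only from [N] on, the outer limit asks for it at every index,
     hence the shift. *)
  exists (fun k => harmonic (k + N)%N), (fun k => z_ (k + N)%N); split.
  - exact: decr0_shift decr0_harmonic.
  - exact: cvg_comp (cvg_addnr N) zz.
  - by move=> k; apply: zE => /=; rewrite leq_addl.
have outer_epi : outer_limit0 E `<=` epigraph (subderivative2 phi x v).
  move=> [w a] [t [z_ [t0 zz zE]]].
  apply: (@subderivative2_le_cvg _ t (fst \o z_) (snd \o z_)) => //.
  - exact: cvg_comp zz cvg_fst.
  - by near=> k; exact: zE.
  - exact: cvg_comp zz cvg_snd.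
split; apply/seteqP; split=> //.
- exact: subset_trans inner_outer outer_epi.
- exact: subset_trans epi_inner inner_outer.
Unshelve. all: by end_near. Qed.

End subderivative.

(** * Difference quotients of the indicator and second-order tangents *)

Section indicator.
Context {R : realType} {n : nat}.
Variables (Omega : set 'rV[R]_n) (x v : 'rV[R]_n).
Hypothesis Ox : Omega x.
Implicit Types (w u : 'rV[R]_n) (t : R).

Local Notation dq := (diff_quot2 (indicator Omega) x v).
Local Notation d2 := (subderivative2 (indicator Omega) x v).

Lemma diff_quot2_indicator t w : 0 < t -> Omega (x + t *: w) ->
  dq t w = (- (2 / t) * dotp v w)%:E.
Proof.
move=> t0 Otw; rewrite /diff_quot2 /indicator !mem_set// sube0 add0e.
by rewrite -EFinN -EFinM; congr EFin; field; rewrite gt_eqF.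
Qed.

Lemma diff_quot2_indicator_lty t w : 0 < t -> (dq t w < +oo)%E ->
  Omega (x + t *: w).
Proof.
move=> t0; rewrite /diff_quot2 /indicator (mem_set Ox).
case: ifPn => [/set_mem//|_]; rewrite sube0 addye// gt0_mulye// lte_fin.
by rewrite invr_gt0 mulr_gt0// exprn_gt0.
Qed.

Lemma diff_quot2_tangent t w u : 0 < t -> dotp v w = 0 ->
  Omega (x + t *: w + (2^-1 * t ^+ 2) *: u) ->
  dq t (w + (t / 2) *: u) = (- dotp v u)%:E.
Proof.
move=> t0 vw0; have -> : x + t *: w + (2^-1 * t ^+ 2) *: u =
    x + t *: (w + (t / 2) *: u).
  by rewrite scalerDr scalerA addrA; congr (_ + _ *: _); field.
move=> /diff_quot2_indicator ->//; rewrite dotpDr dotpZr vw0.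
by congr EFin; field; rewrite gt_eqF.
Qed.

Lemma subderivative2_le_tangent w u :
  dotp v w = 0 -> tangent_set2 Omega x w u -> (d2 w <= (- dotp v u)%:E)%E.
Proof.
move=> vw0 [t [u_ [t0 uu Ou]]].
apply: (@subderivative2_le_cvg _ _ _ _ _ _ t
  (fun k => w + (t k / 2) *: u_ k) (fun k => - dotp v (u_ k))) => //.
- rewrite -[X in _ --> X]addr0 -(scale0r u) -(mul0r 2^-1).
  by apply: cvgD; [exact: cvg_cst|apply: cvgZ => //; apply: cvgMl; case: t0].
- by near=> k; rewrite diff_quot2_tangent//; case: t0.
- by apply: cvgN; apply: cvg_dotp => //; exact: cvg_cst.
Unshelve. all: by end_near. Qed.

Lemma tangent_cone0 : tangent_cone Omega x 0.
Proof.
exists harmonic, (fun=> 0); split; first exact: decr0_harmonic.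
- exact: cvg_cst.
- by move=> k; rewrite scaler0 addr0.
Qed.

(** * Consequences of the proximal inequality *)

Section proximal.
Hypothesis vprox : proximal_normal Omega x v.

Lemma proximal_normal_le : exists2 r, 0 <= r & forall t w, 0 < t ->
  Omega (x + t *: w) -> dotp v w <= r * t * dotp w w.
Proof.
case: vprox => r r0 rP; exists r => // t w t0 /rP.
rewrite addrC addKr dotpZr /enorm sqr_sqrtr ?dotp_ge0// dotpZr dotpZl => h.
rewrite -(ler_pM2l t0); apply: le_trans h _.
by rewrite le_eqVlt; apply/orP; left; apply/eqP; ring.
Qed.

Lemma subderivative2_gtNy w : (-oo < d2 w)%E.
Proof.
have [r r0 rP] := proximal_normal_le.
rewrite ltNge; apply/negP => d2w.
(* The proximal inequality bounds the quotients at [w_ k] below by [- 2 * r * dotp (w_ k) (w_ k)];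
   the summand [1] leaves room for [w_ k] near [w]. *)
have /subderivative2_lt_cvg[t [w_ [[t0 tcvg] ww dqlt]]] :
    (d2 w < (- (2 * r * (dotp w w + 1)))%:E)%E.
  by apply: le_lt_trans d2w _; rewrite ltNyr.
have /filter_ex[k wk] : \forall k \near \oo, dotp (w_ k) (w_ k) <= dotp w w + 1.
  by apply: cvgr_le (cvg_dotp _ _ _ _ _ _ _ ww ww) _ _; rewrite ltrDl.
have Otw : Omega (x + t k *: w_ k).
  by apply: diff_quot2_indicator_lty (t0 k) (lt_trans (dqlt k) (ltry _)).
have := dqlt k; rewrite diff_quot2_indicator// lte_fin; apply/negP.
rewrite -leNgt mulNr lerN2 mulrAC ler_pdivrMr//.
have := rP _ _ (t0 k) Otw.
have : r * t k * dotp (w_ k) (w_ k) <= r * t k * (dotp w w + 1).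
  by rewrite ler_wpM2l// mulr_ge0// ltW.
lra.
Qed.

Lemma subderivative2_lty_critical w :
  (d2 w < +oo)%E -> critical_cone Omega x v w.
Proof.
move=> d2w; have [r r0 rP] := proximal_normal_le.
have [M d2M] : exists M, (d2 w < M%:E)%E.
  case: (d2 w) d2w => [s|//|] _; last by exists 0; rewrite ltNyr.
  by exists (s + 1); rewrite lte_fin ltrDl.
have [t [w_ [[t0 tcvg] ww dqlt]]] := subderivative2_lt_cvg _ _ _ _ _ d2M.
have Otw k : Omega (x + t k *: w_ k).
  by apply: diff_quot2_indicator_lty (t0 k) (lt_trans (dqlt k) (ltry _)).
split; first by exists t, w_.
have vw : dotp v (w_ k) @[k --> \oo] --> dotp v w.
  by apply: cvg_dotp ww; exact: cvg_cst.
(* The proximal inequality bounds [dotp v (w_ k)] above by a multiple of [t k], and the quotients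
   being below [M] bound it below by [- (M / 2) * t k]; both bounds vanish in the limit. *)
apply/eqP; rewrite eq_le; apply/andP; split.
- have : r * t k * dotp (w_ k) (w_ k) @[k --> \oo] --> r * 0 * dotp w w.
    by apply: cvgM; [apply: cvgMr|exact: cvg_dotp].
  rewrite mulr0 mul0r => /(ler_cvg_to vw); apply.
  by near=> k; exact: rP.
- have : - (M / 2) * t k @[k --> \oo] --> - (M / 2) * 0 by apply: cvgMr.
  rewrite mulr0 => /ler_cvg_to/(_ vw); apply; near=> k.
  have := dqlt k; rewrite diff_quot2_indicator// lte_fin => h.
  have : - (2 / t k) * dotp v (w_ k) * t k <= M * t k.
    by rewrite ler_pM2r// ltW.
  have -> : - (2 / t k) * dotp v (w_ k) * t k = - (2 * dotp v (w_ k)).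
    by field; rewrite gt_eqF.
  lra.
Unshelve. all: by end_near. Qed.

End proximal.

(** * Attainment under parabolic regularity, and recovery along arcs *)

Lemma parabolic_regular_attained w : dotp v w = 0 ->
  (d2 w < +oo)%E -> (-oo < d2 w)%E -> parabolically_regular Omega x v ->
  exists2 u, tangent_set2 Omega x w u & d2 w = (- dotp v u)%:E.
Proof.
move=> vw0 d2y d2Ny /(_ w d2y)[t [w_ [[t0 tcvg] ww dqcvg /limn_esup_lty[C eC]]]].
pose u_ k := (2 / t k) *: (w_ k - w).
have wE k : w_ k = w + (t k / 2) *: u_ k.
  rewrite /u_ scalerA mulrA mulfVK// divff ?gt_eqF// scale1r.
  by rewrite addrC subrK.
have [s d2s] : exists s, d2 w = s%:E.
  by case: (d2 w) d2y d2Ny => // s; exists s.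
(* A finite limit makes the quotients eventually finite, which puts the points in [Omega]. *)
have Otu : \forall k \near \oo,
    Omega (x + t k *: w + (2^-1 * t k ^+ 2) *: u_ k).
  move: dqcvg; rewrite d2s => /fine_cvgP[+ _]; apply: filterS => k.
  rewrite fin_numE => /andP[_]; rewrite -ltey.
  move=> /(diff_quot2_indicator_lty _ _ (t0 k)).
  by rewrite wE scalerDr scalerA addrA mulrA -expr2 [_ / 2]mulrC.
(* Regularity gives [enorm (w_ k - w) / t k <= C] eventually, so each coordinate of [u_ k] is at
   most [2 * C] in absolute value. *)
have cC := @rV_compact _ n (fun=> `[- (2 * C), 2 * C]%classic)
  (fun=> @segment_compact R _ _).
have [] := compact_cvg_subsequence _ u_ cC.
  apply: filterS eC => k Ck i /=; rewrite in_itv /= -ler_norml mxE normrM.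
  rewrite gtr0_norm ?divr_gt0// -mulrA ler_pM2l// mulrC.
  by apply: le_trans Ck; rewrite ler_pM2r ?invr_gt0// coord_le_enorm.
move=> u [f [foo fu]].
have Otf : \forall k \near \oo,
    Omega (x + t (f k) *: w + (2^-1 * t (f k) ^+ 2) *: u_ (f k)) := foo _ Otu.
exists u.
  have [N _ NO] := Otf.
  exists (fun k => t (f (k + N)%N)), (fun k => u_ (f (k + N)%N)); split.
  - apply: (decr0_shift (t \o f)); split=> [k|]; first exact: t0.
    exact: cvg_comp foo tcvg.
  - by rewrite (cvg_shiftn N (u_ \o f)).
  - by move=> k; apply: NO => /=; rewrite leq_addl.
have dqf := cvg_comp _ _ foo dqcvg.
(* Along [f] the quotients tend to [d2 w], and being eventually [- dotp v (u_ (f k))] they also tend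
   to [- dotp v u]. *)
apply: (cvg_unique _ dqf) => //.
have : (- dotp v (u_ (f k)))%:E @[k --> \oo] --> (- dotp v u)%:E.
  apply: cvg_EFin; first by near=> k.
  by apply: cvgN; apply: cvg_dotp fu; exact: cvg_cst.
apply: cvg_trans; apply: near_eq_cvg.
by apply: filterS Otf => k Ok /=; rewrite wE diff_quot2_tangent.
Unshelve. all: by end_near. Qed.

(** The direction [(xi t - xi 0) / t] leads from [x] to the arc point [xi t] of [Omega], and its
    second-order part tends to [u]. *)
Lemma arc_recovery w u : dotp v w = 0 -> parabolically_derivable Omega x w ->
  tangent_set2 Omega x w u -> forall t_ : R^nat, decr0 t_ ->
  exists (w_ : nat -> 'rV[R]_n) (q : R^nat),
    [/\ w_ @ \oo --> w, q @ \oo --> - dotp v u &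
      \forall k \near \oo, dq (t_ k) (w_ k) = (q k)%:E].
Proof.
move=> vw0 [_ /[apply]][e [xi [e0 Oxi xi0 xiw xiu]]] t_ t_0.
have tr := decr0_at_right _ t_0.
pose u_ k := (2^-1 * t_ k ^+ 2)^-1 *: (xi (t_ k) - xi 0 - t_ k *: w).
have uu : u_ @ \oo --> u by exact: cvg_comp tr xiu.
exists (fun k => (t_ k)^-1 *: (xi (t_ k) - xi 0)), (fun k => - dotp v (u_ k)).
split; first exact: cvg_comp tr xiw.
  by apply: cvgN; apply: cvg_dotp uu; exact: cvg_cst.
have te : \forall k \near \oo, t_ k <= e := tr _ (nbhs_right_le e0).
apply: filterS te => k te; have tk0 : 0 < t_ k by case: t_0.
have -> : (t_ k)^-1 *: (xi (t_ k) - xi 0) = w + (t_ k / 2) *: u_ k.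
  rewrite /u_ scalerA.
  have -> : t_ k / 2 / (2^-1 * t_ k ^+ 2) = (t_ k)^-1 by field; rewrite gt_eqF.
  by rewrite [in RHS]scalerBr scalerA mulVf ?gt_eqF// scale1r [RHS]addrC subrK.
rewrite diff_quot2_tangent// /u_ scalerA divff ?scale1r; last first.
  by rewrite mulf_neq0// gt_eqF// ?invr_gt0// exprn_gt0.
rewrite xi0 -(addrA (xi _)) -opprD [X in Omega X]addrC subrK.
by apply: Oxi; rewrite ltW.
Qed.

End indicator.

Theorem theorem3p6 (R : realType) (n : nat) (Omega : set 'rV[R]_n)
  (xbar vbar : 'rV[R]_n)
  (Omega_closed : closed Omega) (xbar_in : Omega xbar)
  (vbar_prox : proximal_normal Omega xbar vbar)
  (Omega_derivable : forall w, critical_cone Omega xbar vbar w ->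
     parabolically_derivable Omega xbar w)
  (Omega_regular : parabolically_regular Omega xbar vbar) :
  properly_twice_epi_differentiable (indicator Omega) xbar vbar /\
  forall w, subderivative2 (indicator Omega) xbar vbar w =
    if w \in critical_cone Omega xbar vbar
    then (- support_fun (tangent_set2 Omega xbar w) vbar)%E
    else +oo%E.
Proof.
set d2 := subderivative2 _ _ _.
have d2Ny w : (-oo < d2 w)%E by exact: subderivative2_gtNy.
have d2_critical w : (d2 w < +oo)%E -> critical_cone Omega xbar vbar w.
  exact: subderivative2_lty_critical.
have critical_d2 w : critical_cone Omega xbar vbar w -> (d2 w < +oo)%E.
  (* Parabolic derivability makes the second-order tangent set nonempty, and any of its elements
     gives a finite upper bound. *)
  move=> Kw; have [[u Tu] _] := Omega_derivable w Kw.
  by apply: le_lt_trans (ltry _); apply: subderivative2_le_tangent Tu; case: Kw.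
have attained w : critical_cone Omega xbar vbar w ->
    exists2 u, tangent_set2 Omega xbar w u & d2 w = (- dotp vbar u)%:E.
  move=> Kw; apply: parabolic_regular_attained => //; first by case: Kw.
  exact: critical_d2.
split; [split; [|split]|].
- apply: twice_epi_differentiable_of_recovery => w a wa t t0.
  have Kw : critical_cone Omega xbar vbar w.
    by exact: d2_critical (le_lt_trans wa (ltry a)).
  have [u Tu d2u] := attained w Kw; have vw0 : dotp vbar w = 0 by case: Kw.
  have [w_ [q [ww qu dq]]] :=
    arc_recovery _ _ _ xbar_in _ _ vw0 (Omega_derivable w Kw) Tu _ t0.
  (* The added constant is [a - d2 w], nonnegative by [wa]; it moves the limit from [d2 w] up to
     [a]. *)
  exists w_, (fun k => q k + (a + dotp vbar u)); split=> //.
    have : q k + (a + dotp vbar u) @[k --> \oo] -->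
        - dotp vbar u + (a + dotp vbar u).
      by apply: cvgD qu _; exact: cvg_cst.
    by rewrite addrCA addNr addr0.
  apply: filterS dq => k ->; rewrite lee_fin lerDl.
  by move: wa; rewrite -/d2 d2u lee_fin -subr_ge0 opprK.
- by move=> w; rewrite -/d2 gt_eqF.
- exists 0; rewrite -/d2 lt_eqF// critical_d2//; split; first exact: tangent_cone0.
  by rewrite /= /dotp big1// => i _; rewrite mxE mulr0.
move=> w; case: ifPn => [/set_mem Kw|/negP wK]; last first.
  apply/eqP; rewrite eq_le leey leNgt; apply/negP => /d2_critical Kw.
  by apply: wK; exact: mem_set.
have [u Tu d2u] := attained w Kw.
(* Every second-order tangent gives the upper bound; the tangent [u] attaining [d2 w] gives the
   lower one. *)
apply/eqP; rewrite eq_le; apply/andP; split.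
- rewrite leeNr; apply/ereal_supP => _ [u' Tu' <-].
  by rewrite leeNr -EFinN; apply: subderivative2_le_tangent Tu'; case: Kw.
- by rewrite d2u EFinN leeN2; apply: ereal_sup_ubound; exists u.
Qed.
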